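(* Let $G$ be a finite group acting by symmetries $\alpha_g$ on a generalized probabilistic theory $T$ with effect set $\mathcal E(T)$ and operation set $\mathcal O(T)$. Suppose $\mathcal E(T)\subseteq\mathcal E_{\max}$ and that $\alpha_{\vec g}\circ\Lambda\circ\alpha_{\vec g}^{-1}$ is completely positive for every $\Lambda\in\mathcal O(T)$ and every tuple $\vec g$. Then $G$ is at worst weakly nonphysical. Conversely, if $G$ is weakly nonphysical, then $\mathcal E(T)\subseteq\mathcal E_{\max}$.
   Context: **Theories.** Each wire of $T$ has a finite-dimensional real vector space; a system is a finite list of wires with the tensor product space (tomographic locality). Each system has a convex set of normalised states $\Omega$ spanning the space and a convex set of effects $\mathcal E(T)$ (linear functionals with values in $[0,1]$ on states, containing $0$ and the unit effect, closed under $E\mapsto\text{unit}-E$). Operations in $\mathcal O(T)$ are normalisation-preserving linear maps between systems, closed under sequential composition and under tensoring with identities, mapping states to states. Input and output wires of an operation are labelled by a common index set (each label on at most one input and one output wire). **Symmetries.** $G$ acts on each wire $w$ by reversible linear maps $\alpha_g^w$; the collective action $\alpha_g^{\otimes k}$ preserves states, effects, the pairing, and $\mathcal O(T)$ under conjugation. For a tuple $\vec g$ indexed by wires (labels), $\alpha_{\vec g}=\bigotimes_w\alpha_{g_w}^w$, acting on functionals by duality so that $\langle\alpha_{\vec g}(E),\alpha_{\vec g}(\omega)\rangle=\langle E,\omega\rangle$; in $\alpha_{\vec g}\circ\Lambda\circ\alpha_{\vec g}^{-1}$ input and output wires with the same label carry the same group element. **Maximal sets.** $\Omega^\vee=\{E:0\le\langle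 E,\omega\rangle\le1\ \forall\omega\in\Omega\}$ for each system, and $\mathcal E_{\max}=\{E:\alpha_{\vec g}(E)\in\Omega^\vee\ \text{for all tuples }\vec g\}$, for every number of wires. **Completely positive** means: tensored with the identity on any further system, the map sends the cone generated by the states into the cone generated by the states (the usual notion for quantum systems with all density matrices as states). **Physicality.** A closed circuit with insertions consists of a state, a sequence of maps each of which is either an operation in $\mathcal O(T)$ or some $\alpha_{\vec g}$ acting on the wires present, and a final effect; its value is the resulting number. $G$ is physical if each of its transformations is an operation of $T$; it is strongly nonphysical if some closed circuit with insertions has a value outside $[0,1]$; it is weakly nonphysical if it is neither physical nor strongly nonphysical. ''At worst weakly nonphysical'' means not strongly nonphysical.
   Formalization: The unit effect of a composite system is taken to be the tensor product of the unit effects of its wires (the usual convention); without this, local tuples need not preserve normalisation and the first implication can fail. *)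

(* Defs.v *)
From HB Require Import structures.
From mathcomp Require Import all_boot all_order all_algebra all_fingroup.
From mathcomp Require Import all_character.
From mathcomp Require Import mxtens.
From mathcomp Require Import boolp classical_sets reals convex.

Set Implicit Arguments.
Unset Strict Implicit.
Unset Printing Implicit Defensive.

Import Order.TTheory GRing.Theory Num.Theory.

Local Open Scope classical_set_scope.
Local Open Scope ring_scope.

(* The space of a wire w is R^(d w), a system is a list of wires, and the space
   of w1 :: ... :: wk is R^(d w1) (x) ... (x) R^(d wk), identified with
   R^(d w1 * ... * d wk) through the Kronecker product [tensmx].  Vectors are
   columns, functionals are rows and linear maps are matrices acting on columns
   from the left. *)
Fixpoint sysdim (W : Type) (d : W -> nat) (s : seq W) : nat :=
  if s is w :: s' then (d w * sysdim d s')%N else 1%N.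

Lemma sysdim_cat (W : Type) (d : W -> nat) (s t : seq W) :
  sysdim d (s ++ t) = (sysdim d s * sysdim d t)%N.
Proof. by elim: s => [|w s IHs] /=; rewrite ?mul1n // IHs mulnA. Qed.

Fixpoint tens_unit (R : realType) (W : Type) (d : W -> nat)
    (u : forall w, 'rV[R]_(d w)) (s : seq W) : 'rV[R]_(sysdim d s) :=
  if s is w :: s' then tensmx (u w) (tens_unit u s') : 'rV[R]__ else 1%:M.

Definition tens (R : realType) (W : Type) (d : W -> nat) (s1 t1 s2 t2 : seq W)
    (A : 'M[R]_(sysdim d t1, sysdim d s1)) (B : 'M[R]_(sysdim d t2, sysdim d s2)) :
    'M[R]_(sysdim d (t1 ++ t2), sysdim d (s1 ++ s2)) :=
  castmx (esym (sysdim_cat d t1 t2), esym (sysdim_cat d s1 s2)) (tensmx A B).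

(* [op ls lt L] reads: the linear map L, with its i-th input wire labelled
   nth ls i and its j-th output wire labelled nth lt j, is an operation. *)
Record gpt_data (R : realType) := GptData {
  wire : Type;
  wdim : wire -> nat;
  wunit : forall w, 'rV[R]_(wdim w);
  states : forall s : seq wire, set 'cV[R]_(sysdim wdim s);
  effects : forall s : seq wire, set 'rV[R]_(sysdim wdim s);
  op : forall s t : seq wire, seq nat -> seq nat ->
         set 'M[R]_(sysdim wdim t, sysdim wdim s)
}.
Arguments wdim {R g}.
Arguments wunit {R g}.
Arguments states {R} g s.
Arguments effects {R} g s.
Arguments op {R} g {s t}.

Definition sdim (R : realType) (T : gpt_data R) (s : seq (wire T)) : nat :=
  sysdim wdim s.

Section Theories.
Context {R : realType} {T : gpt_data R}.
Implicit Types (s t k : seq (wire T)).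

Definition pairing s (E : 'rV[R]_(sdim s)) (v : 'cV[R]_(sdim s)) : R :=
  (E *m v) 0 0.

(* The unit effect of a system is the product of the unit effects of its
   wires. *)
Definition sysunit s : 'rV[R]_(sdim s) := tens_unit wunit s.

Definition is_op s t (L : 'M[R]_(sdim t, sdim s)) : Prop :=
  exists ls lt : seq nat, op T ls lt L.

End Theories.

Definition spans (R : realType) (n : nat) (A : set 'cV[R]_n) : Prop :=
  forall v, exists2 X : seq 'cV[R]_n, {in X, forall x, A x} & v \in <<X>>%VS.

Record is_gpt (R : realType) (T : gpt_data R) : Prop := IsGpt {
  states_convex : forall s,
    convex_set (states T s : set (convex_lmodType 'cV[R]_(sdim s)));
  states_span : forall s, spans (states T s);
  states_normalised : forall s w, states T s w -> pairing (sysunit s) w = 1;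
  effects_convex : forall s,
    convex_set (effects T s : set (convex_lmodType 'rV[R]_(sdim s)));
  effects_01 : forall s E w,
    effects T s E -> states T s w -> 0 <= pairing E w <= 1;
  effects_0 : forall s, effects T s 0;
  effects_unit : forall s, effects T s (sysunit s);
  effects_compl : forall s E, effects T s E -> effects T s (sysunit s - E);
  op_labels : forall s t ls lt (L : 'M[R]_(sdim t, sdim s)), op T ls lt L ->
    [/\ size ls = size s, size lt = size t, uniq ls & uniq lt];
  op_normalised : forall s t ls lt (L : 'M[R]_(sdim t, sdim s)), op T ls lt L ->
    sysunit t *m L = sysunit s;
  op_states : forall s t ls lt (L : 'M[R]_(sdim t, sdim s)), op T ls lt L ->
    forall w, states T s w -> states T t (L *m w);
  op_comp : forall s t r ls lt lr
      (L : 'M[R]_(sdim t, sdim s)) (L' : 'M[R]_(sdim r, sdim t)),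
    op T ls lt L -> op T lt lr L' -> op T ls lr (L' *m L : 'M_(sdim r, sdim s));
  (* an identity wire carries the same, fresh, label at both ends *)
  op_tens_id : forall s t k ls lt lk (L : 'M[R]_(sdim t, sdim s)),
    op T ls lt L -> size lk = size k -> uniq (ls ++ lk) -> uniq (lt ++ lk) ->
    op T (ls ++ lk) (lt ++ lk) (tens L (1%:M : 'M[R]_(sdim k)));
  op_id_tens : forall s t k ls lt lk (L : 'M[R]_(sdim t, sdim s)),
    op T ls lt L -> size lk = size k -> uniq (lk ++ ls) -> uniq (lk ++ lt) ->
    op T (lk ++ ls) (lk ++ lt) (tens (1%:M : 'M[R]_(sdim k)) L)
}.

(* Acting on columns from the left, a matrix representation is a left action. *)
Definition wire_action (R : realType) (gT : finGroupType) (T : gpt_data R) :=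
  forall w : wire T, mx_representation R [set: gT]%SET (wdim w).

Fixpoint tens_action (R : realType) (gT : finGroupType) (W : Type)
    (d : W -> nat) (a : forall w, mx_representation R [set: gT]%SET (d w))
    (s : seq W) (gs : seq gT) : 'M[R]_(sysdim d s) :=
  if s is w :: s' then
    tensmx (a w (head 1%g gs)) (tens_action a s' (behead gs))
  else 1%:M.

Section Symmetries.
Context {R : realType} {gT : finGroupType} {T : gpt_data R}.
Variable a : wire_action gT T.
Implicit Types (s t k : seq (wire T)) (gs : seq gT).

(* The i-th wire of s carries nth gs i; only used when size gs = size s. *)
Definition sysact s gs : 'M[R]_(sdim s) := tens_action a s gs.

Definition act_eff s gs (E : 'rV[R]_(sdim s)) : 'rV[R]_(sdim s) :=
  E *m invmx (sysact s gs).

Definition conj_op s t (ls lt : seq nat) (g : nat -> gT)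
    (L : 'M[R]_(sdim t, sdim s)) : 'M[R]_(sdim t, sdim s) :=
  sysact t (map g lt) *m L *m invmx (sysact s (map g ls)).

(* Preservation of the pairing is built into the definition of [act_eff]. *)
Record is_symmetry : Prop := IsSymmetry {
  states_sym : forall g s w,
    states T s w -> states T s (sysact s (nseq (size s) g) *m w);
  effects_sym : forall g s E,
    effects T s E -> effects T s (act_eff (nseq (size s) g) E);
  op_sym : forall g s t ls lt (L : 'M[R]_(sdim t, sdim s)),
    op T ls lt L -> op T ls lt (conj_op ls lt (fun=> g) L)
}.

Definition dual_states s : set 'rV[R]_(sdim s) :=
  [set E | forall w, states T s w -> 0 <= pairing E w <= 1].

Definition effects_max s : set 'rV[R]_(sdim s) :=
  [set E | forall gs, size gs = size s -> dual_states (act_eff gs E)].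

(* Labels play no role in circuits: maps are composed along the list of wires
   present, whatever labels the operations carry. *)
Inductive circuit_map s : forall t, 'M[R]_(sdim t, sdim s) -> Prop :=
| circuit_nil : @circuit_map s s 1%:M
| circuit_op t r (M : 'M[R]_(sdim t, sdim s)) (L : 'M[R]_(sdim r, sdim t)) :
    circuit_map M -> is_op L -> @circuit_map s r (L *m M)
| circuit_act t (M : 'M[R]_(sdim t, sdim s)) gs :
    circuit_map M -> size gs = size t -> @circuit_map s t (sysact t gs *m M).

Definition circuit_value (x : R) : Prop :=
  exists s t (w : 'cV[R]_(sdim s)) (M : 'M[R]_(sdim t, sdim s))
    (E : 'rV[R]_(sdim t)),
    [/\ states T s w, circuit_map M, effects T t E & x = pairing E (M *m w)].

(* The transformations of G are the maps a w g on the wires w. *)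
Definition physical : Prop :=
  forall (g : gT) (w : wire T), is_op (sysact [:: w] [:: g]).

Definition strongly_nonphysical : Prop :=
  exists2 x, circuit_value x & ~ (0 <= x <= 1).

Definition weakly_nonphysical : Prop := ~ physical /\ ~ strongly_nonphysical.

End Symmetries.
Arguments effects_max {R gT T} a s.

Definition cone (R : realType) (n : nat) (A : set 'cV[R]_n) : set 'cV[R]_n :=
  [set v | exists m (c : 'I_m -> R) (x : 'I_m -> 'cV[R]_n),
     [/\ forall i, 0 <= c i, forall i, A (x i) & v = \sum_i c i *: x i]].

Definition completely_positive (R : realType) (T : gpt_data R)
    (s t : seq (wire T)) (L : 'M[R]_(sdim t, sdim s)) : Prop :=
  forall (k : seq (wire T)) (v : 'cV[R]_(sdim (s ++ k))),
    cone (states T (s ++ k)) v ->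
    cone (states T (t ++ k)) (tens L (1%:M : 'M[R]_(sdim k)) *m v).

(* Main.v *)
(** Every map of the group can be pushed to the end of a circuit: an operation
    L applied after a tuple g equals a tuple applied after a conjugate of L, and
    conjugates of operations preserve the cone of states by complete positivity.
    The output of a circuit is thus a tuple applied to a vector of this cone,
    which is normalised since the group preserves the unit effects; the dual
    action turns the final effect into an element of the dual of the states.
    Conversely, the value of a translated effect on a state is the value of a
    circuit containing a single group insertion. *)
Require Import Defs.
From HB Require Import structures.
From mathcomp Require Import all_boot all_order all_algebra all_fingroup.
From mathcomp Require Import all_character.
From mathcomp Require Import mxtens.
From mathcomp Require Import boolp classical_sets reals.

Set Implicit Arguments.
Unset Strict Implicit.
Unset Printing Implicit Defensive.

Import Order.TTheory GRing.Theory Num.Theory.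
Local Open Scope classical_set_scope.
Local Open Scope ring_scope.

Lemma tensmx11 (R : comPzRingType) (m n : nat) :
  tensmx (1%:M : 'M[R]_m) (1%:M : 'M[R]_n) = 1%:M.
Proof.
apply/matrixP=> i j.
case: (mxtens_indexP i) => i0 i1; case: (mxtens_indexP j) => j0 j1.
rewrite tensmxE !mxE (can_eq (@mxtens_indexK m n)) xpair_eqE.
by case: eqP => _; case: eqP => _; rewrite ?mulr1 ?mulr0.
Qed.

Lemma castmx_conj (R : pzRingType) (m m' n n' p : nat)
    (em : m' = m) (en : n = n') (A : 'M[R]_(m, n)) (B : 'M[R]_(n, p)) :
  castmx (em, erefl) (castmx (esym em, en) A *m castmx (en, erefl) B) = A *m B.
Proof. by case: m / em A; case: n' / en => A; rewrite !castmx_id. Qed.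

Section TensorAction.
Variables (R : realType) (gT : finGroupType) (T : gpt_data R).
Variable a : wire_action gT T.
Implicit Types (s t : seq (wire T)) (gs : seq gT).

Lemma sysact_mul s gs hs : size gs = size s -> size hs = size s ->
  sysact a s gs *m sysact a s hs
    = sysact a s [seq (p.1 * p.2)%g | p <- zip gs hs].
Proof.
rewrite /sysact /sdim.
elim: s gs hs => [|w s IHs] [|g gs] [|h hs] //=; first by rewrite mul1mx.
by move=> [szgs] [szhs]; rewrite tensmx_mul -repr_mxM ?inE // IHs.
Qed.

(** No length condition is needed: missing entries of [gs] default to the identity, which is its own
    inverse. *)
Lemma sysact_mulV s gs :
  sysact a s gs *m sysact a s (map invg gs) = 1%:M.
Proof.
rewrite /sysact /sdim; elim: s gs => [|w s IHs] gs /=; first by rewrite mul1mx.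
rewrite tensmx_mul behead_map IHs.
have -> : head 1%g (map invg gs) = (head 1%g gs)^-1%g.
  by case: gs => [|g gs] //=; rewrite invg1.
by rewrite -repr_mxM ?inE // mulgV repr_mx1 tensmx11.
Qed.

Lemma sysact_mulVr s gs :
  sysact a s (map invg gs) *m sysact a s gs = 1%:M.
Proof. exact: (mulmx1C (sysact_mulV s gs)). Qed.

Lemma invmx_sysact s gs : invmx (sysact a s gs) = sysact a s (map invg gs).
Proof.
have [u _] := mulmx1_unit (sysact_mulV s gs).
by rewrite -[RHS](mulKmx u) sysact_mulV mulmx1.
Qed.

Lemma map_invgK gs : map invg (map invg gs) = gs.
Proof. by rewrite -map_comp map_id_in // => x _; rewrite /= invgK. Qed.

Hypotheses (hT : is_gpt T) (ha : is_symmetry a).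

(** The states span the space, so a functional is determined by its values on them. *)
Lemma eq_functional s (E F : 'rV[R]_(sdim s)) :
  (forall w, states T s w -> E *m w = F *m w) -> E = F.
Proof.
move=> eqEF; suff EFv (v : 'cV_(sdim s)) : E *m v = F *m v.
  apply/matrixP => i j.
  by have /matrixP/(_ i 0) := EFv (delta_mx j 0); rewrite -!colE !mxE.
have [X XS vX] := states_span hT v.
rewrite (coord_span (X := in_tuple X) vX) !mulmx_sumr; apply: eq_bigr => i _.
by rewrite -!scalemxAr eqEF //; apply: XS; apply: mem_nth.
Qed.

Lemma sysunit_state s (w : 'cV[R]_(sdim s)) :
  states T s w -> sysunit s *m w = 1%:M.
Proof.
move=> /(states_normalised hT) w1.
by rewrite [LHS]mx11_scalar -[_ 0 0]/(pairing _ _) w1.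
Qed.

(** On a one-wire system the collective action is the action on that wire; it maps states to states,
    where the unit effect is constantly 1. *)
Lemma wunit_act (w : wire T) (g : gT) : wunit w *m a w g = wunit w.
Proof.
have actu : sysunit [:: w] *m sysact a [:: w] [:: g] = sysunit [:: w].
  apply: eq_functional => v Sv.
  rewrite -mulmxA (sysunit_state Sv) sysunit_state //.
  exact: (states_sym ha g Sv).
(* The empty tail of [[:: w]] contributes a trivial 1 by 1 tensor factor, which is stripped by
   comparing entries. *)
have /matrixP eqU : tensmx (wunit w *m a w g) (1%:M : 'M[R]_1)
    = tensmx (wunit w) (1%:M : 'M[R]_1).
  by rewrite -[1%:M in LHS]mul1mx -tensmx_mul; exact: actu.
apply/matrixP => i j.
have := eqU (mxtens_index (i, ord0)) (mxtens_index (j, ord0)).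
by rewrite !tensmxE !mxE eqxx !mulr1.
Qed.

(** Invariance on each wire separately extends to tuples with different group elements, although a
    symmetry preserves states only under the collective action. *)
Lemma sysunit_act s gs : sysunit s *m sysact a s gs = sysunit s.
Proof.
rewrite /sysunit /sysact /sdim.
elim: s gs => [|w s IHs] gs /=; first by rewrite mulmx1.
have := tensmx_mul (wunit w) (tens_unit wunit s) (a w (head 1%g gs))
  (tens_action a s (behead gs)).
by rewrite wunit_act IHs.
Qed.

Lemma sysunit_circuit s t (M : 'M[R]_(sdim t, sdim s)) :
  circuit_map a M -> sysunit t *m M = sysunit s.
Proof.
elim=> [|{}t r {}M L _ IHM [ls [lt opL]]|{}t {}M gs _ IHM _].
- by rewrite mulmx1.
- by rewrite mulmxA (op_normalised hT opL).
- by rewrite mulmxA sysunit_act.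
Qed.

Lemma pairing_act_eff s gs (E : 'rV[R]_(sdim s)) (v : 'cV[R]_(sdim s)) :
  pairing (act_eff a gs E) v = pairing E (sysact a s (map invg gs) *m v).
Proof. by rewrite /pairing /act_eff invmx_sysact mulmxA. Qed.

Lemma op_act s t ls lt (L : 'M[R]_(sdim t, sdim s)) gs :
    op T ls lt L -> size gs = size s ->
  exists (g : nat -> gT) (hs : seq gT),
    size hs = size t /\
    L *m sysact a s gs = sysact a t hs *m conj_op a ls lt g L.
Proof.
move=> /(op_labels hT)[szls szlt uls _] szgs.
(* The element of a label is the inverse of the entry of [gs] at its input wire, so that the right
   factor of the conjugate is the action of [gs]. Labels are distinct on the inputs, so this is
   consistent; a label found only on an output gets the default 1. *)
pose g n := ((nth 1%g gs (index n ls))^-1)%g.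
have gls : map g ls = map invg gs.
  apply: (@eq_from_nth _ 1%g) => [|i]; rewrite !size_map ?szls ?szgs // => ils.
  rewrite (nth_map 0%N) ?szls // (nth_map 1%g) ?szgs //.
  by rewrite /g index_uniq ?szls.
exists g, (map invg (map g lt)); rewrite !size_map szlt; split=> //.
rewrite /conj_op invmx_sysact gls map_invgK.
by rewrite !mulmxA sysact_mulVr mul1mx.
Qed.

End TensorAction.

Lemma cone_sub (R : realType) (n : nat) (A : set 'cV[R]_n) : A `<=` cone A.
Proof.
move=> v Av; exists 1%N, (fun=> 1), (fun=> v); split=> //.
by rewrite big_ord1 scale1r.
Qed.

Lemma cone_cast (R : realType) (T : gpt_data R) (s t : seq (wire T))
    (e : s = t) (es : sdim s = sdim t) (v : 'cV[R]_(sdim s)) :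
  cone (states T s) v -> cone (states T t) (castmx (es, erefl) v).
Proof. by case: t / e es => es; rewrite castmx_id. Qed.

(** Take the empty auxiliary system; the casts only identify [s ++ [::]] with [s]. *)
Lemma completely_positive_cone (R : realType) (T : gpt_data R)
    (s t : seq (wire T)) (L : 'M[R]_(sdim t, sdim s)) (v : 'cV[R]_(sdim s)) :
  completely_positive L -> cone (states T s) v -> cone (states T t) (L *m v).
Proof.
have es : sdim s = sdim (s ++ [::]) by rewrite cats0.
have et : sdim (t ++ [::]) = sdim t by rewrite cats0.
move=> cpL /(cone_cast (esym (cats0 s)) es) /(cpL [::]).
move=> /(cone_cast (cats0 t) et).
have -> : tens L (1%:M : 'M[R]_(sdim [::])) = castmx (esym et, es) L.
  rewrite /tens (tens_mx_scalar 1 L) scale1r castmx_comp.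
  by congr (castmx (_, _) L); apply: eq_irrelevance.
by rewrite (castmx_conj et es).
Qed.

Section Circuits.
Variables (R : realType) (gT : finGroupType) (T : gpt_data R).
Variable a : wire_action gT T.
Hypotheses (hT : is_gpt T) (ha : is_symmetry a).
Implicit Types (s t : seq (wire T)) (gs : seq gT).

Lemma circuit_normal_form s t (M : 'M[R]_(sdim t, sdim s)) (w : 'cV[R]_(sdim s)) :
    (forall s t ls lt (L : 'M[R]_(sdim t, sdim s)), op T ls lt L ->
       forall g, completely_positive (conj_op a ls lt g L)) ->
    circuit_map a M -> states T s w ->
  exists gs v, [/\ size gs = size t, cone (states T t) v
    & M *m w = sysact a t gs *m v].
Proof.
move=> cp cM Sw.
elim: cM => [|{}t r {}M L _ [gs [v [szgs Cv Mw]]] [ls [lt opL]]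
            |{}t {}M hs _ [gs [v [szgs Cv Mw]]] szhs].
(* The collective action of 1 keeps [w] a state, and the inverse tuple undoes it. *)
- exists (map invg (nseq (size s) 1%g)), (sysact a s (nseq (size s) 1%g) *m w).
  split; first by rewrite size_map size_nseq.
    by apply: cone_sub; apply: states_sym.
  by rewrite mulmxA sysact_mulVr.
- have [g [hs [szhs eqL]]] := op_act a hT opL szgs.
  exists hs, (conj_op a ls lt g L *m v); split=> //.
    exact: completely_positive_cone (cp _ _ _ _ _ opL g) Cv.
  by rewrite -mulmxA Mw mulmxA eqL mulmxA.
- exists [seq (p.1 * p.2)%g | p <- zip hs gs], v; split=> //.
    by rewrite size_map size_zip szhs szgs minnn.
  rewrite -mulmxA Mw mulmxA; congr (_ *m v).
  exact: sysact_mul.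
Qed.

(** Normalisation forces the coefficients to sum to 1, so [v] is a convex combination of states. *)
Lemma dual_states_cone s (E : 'rV[R]_(sdim s)) (v : 'cV[R]_(sdim s)) :
    dual_states E -> cone (states T s) v -> sysunit s *m v = 1%:M ->
  0 <= pairing E v <= 1.
Proof.
move=> dE [m [c [x [c0 Sx ->]]]].
rewrite /pairing !mulmx_sumr.
under eq_bigr => i _ do rewrite -scalemxAr (sysunit_state hT) //.
rewrite -scaler_suml => /matrixP/(_ 0 0); rewrite !mxE mulr1 => c1.
rewrite summxE; under eq_bigr => i _ do rewrite -scalemxAr mxE.
have dEx i : 0 <= (E *m x i) 0 0 <= 1 := dE _ (Sx i).
apply/andP; split.
  by apply: sumr_ge0 => i _; rewrite mulr_ge0 //; case/andP: (dEx i).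
rewrite -[leRHS]c1; apply: ler_sum => i _.
by rewrite ler_piMr //; case/andP: (dEx i).
Qed.

End Circuits.

Theorem proposition21 (R : realType) (gT : finGroupType) (T : gpt_data R)
    (a : wire_action gT T) (hT : is_gpt T) (ha : is_symmetry a) :
  ((forall s : seq (wire T), effects T s `<=` effects_max a s) ->
   (forall (s t : seq (wire T)) (ls lt : seq nat) (L : 'M[R]_(sdim t, sdim s)),
      op T ls lt L ->
      forall g : nat -> gT, completely_positive (conj_op a ls lt g L)) ->
   ~ strongly_nonphysical a)
  /\
  (weakly_nonphysical a ->
   forall s : seq (wire T), effects T s `<=` effects_max a s).
Proof.
split=> [Emax cp [x [s [t [w [M [E [Sw cM EE ->]]]]]]]
        |[_ nstrong] s E EE gs szgs w Sw].
  apply; have [gs [v [szgs Cv Mw]]] := circuit_normal_form hT ha cp cM Sw.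
  have uv : sysunit t *m v = 1%:M.
    rewrite -(sysunit_act hT ha t gs) -mulmxA -Mw mulmxA.
    by rewrite (sysunit_circuit hT ha cM) sysunit_state.
  (* Writing [gs] as a double inverse lets the tuple pass to the effect as the dual action of
     [map invg gs]. *)
  rewrite Mw -(map_invgK gs) -pairing_act_eff.
  apply: (dual_states_cone hT) => //; apply: (Emax _ _ EE).
  by rewrite size_map.
apply: contrapT => nE; apply: nstrong.
exists (pairing (act_eff a gs E) w) => //.
(* The inserted tuple is inverted because functionals transform by duality. *)
exists s, s, w, (sysact a s (map invg gs) *m 1%:M), E; split=> //.
  by apply: circuit_act; [exact: circuit_nil|rewrite size_map].
by rewrite pairing_act_eff mulmx1.
Qed.
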